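(* Let $t\ge1$ and let $G$ be a group of order $4t+2$. (i) If $\psi\in Z^2(G,\langle-1\rangle)$ is quasi-orthogonal, then $T=\{(1,g):g\in G\}$ is a quasi-Hadamard subset of $E_\psi$ with respect to the central subgroup $Z=\{(1,1),(-1,1)\}$. (ii) Let $E$ be a group with a central subgroup $\langle -1\rangle$ of order $2$ such that $E/\langle-1\rangle\cong G$ (identify $G=E/\langle -1\rangle$). If $T$ is a quasi-Hadamard subset of $E$ with respect to $\langle-1\rangle$ and $1\in T$, then $\psi_T$ is quasi-orthogonal.
   Context: A (normalized) cocycle is a map $\psi:G\times G\to\{\pm1\}$ with $\psi(g,h)\psi(gh,k)=\psi(g,hk)\psi(h,k)$ for all $g,h,k$ and $\psi(1,1)=1$; $Z^2(G,\langle-1\rangle)$ is the set of these. For an ordering $g_1=1,\dots,g_{4t+2}$ of $G$, $M_\psi=[\psi(g_i,g_j)]_{i,j}$; for an $n\times n$ $(\pm1)$-matrix $M$ with first row all $1$s, $RE(M)=\sum_{i=2}^n|\sum_j m_{i,j}|$; $\psi$ is quasi-orthogonal if $RE(M_\psi)=4t$. $E_\psi$ is the group with elements $\{(u,g):u\in\{\pm1\},g\in G\}$ and multiplication $(u,g)(v,h)=(uv\,\psi(g,h),gh)$. Given a group $E$ of order $8t+4\ge 12$ with a central subgroup $Z$ of order $2$, a quasi-Hadamard subset of $E$ (with respect to $Z$) is a transversal $T$ for the cosets of $Z$ in $E$ containing a subset $S\subset T\setminus Z$ with $|S|=2t+1$ such that $|T\cap xT|=2t+1$ for all $x\in S$ and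 $|T\cap xT|\in\{2t,2t+2\}$ for all $x\in T\setminus(S\cup Z)$. For a transversal $T$ of $\langle-1\rangle$ in $E$ with $1\in T$, let $\sigma:G\to T$ send each coset to its representative in $T$, and define $\psi_T(g,h)=\sigma(g)\sigma(h)\sigma(gh)^{-1}\in\langle-1\rangle$; this is a cocycle in $Z^2(G,\langle-1\rangle)$. *)

(* Defs.v *)
From HB Require Import structures.
From mathcomp Require Import all_boot all_order all_algebra all_fingroup all_solvable.

Set Implicit Arguments.
Unset Strict Implicit.
Unset Printing Implicit Defensive.

Import GroupScope.

(* The multiplicative group {1, -1}, as a finite subtype of int. *)

Definition pm1 : Type := seq_sub [:: 1%R; (-1)%R : int].
HB.instance Definition _ := Finite.on pm1.
HB.instance Definition _ := SubType.on pm1.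

Fact pm1_mul_subproof (u v : pm1) :
  (val u * val v)%R \in [:: 1%R; (-1)%R : int].
Proof. by case: u v => [u +] [v +] /=; rewrite !inE => /pred2P[]-> /pred2P[]->. Qed.

Definition pm1_one : pm1 := SeqSub (mem_head 1%R [:: (-1)%R : int]).
Definition pm1_neg : pm1 := SeqSub (mem_last 1%R [:: (-1)%R : int]).
Definition pm1_mul (u v : pm1) : pm1 := SeqSub (pm1_mul_subproof u v).

Fact pm1_mulA : associative pm1_mul.
Proof. by move=> u v w; apply: val_inj; apply: GRing.mulrA. Qed.
Fact pm1_mul1 : left_id pm1_one pm1_mul.
Proof. by move=> u; apply: val_inj; apply: GRing.mul1r. Qed.
Fact pm1_mulV : left_inverse pm1_one id pm1_mul.
Proof.
move=> u; apply: val_inj; case: u => u /=.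
by rewrite !inE => /pred2P[]->.
Qed.

HB.instance Definition _ := Finite_isGroup.Build pm1 pm1_mulA pm1_mul1 pm1_mulV.

Lemma pm1_mulC (u v : pm1) : u * v = v * u.
Proof. by apply: val_inj; apply: GRing.mulrC. Qed.

Lemma pm1_sqr (u : pm1) : u * u = 1.
Proof. exact: pm1_mulV. Qed.

Record cocycle (gT : finGroupType) := Cocycle {
  cocycle_fun :> gT -> gT -> pm1;
  cocycleP : forall g h k : gT,
    cocycle_fun g h * cocycle_fun (g * h) k
      = cocycle_fun g (h * k) * cocycle_fun h k;
  cocycle11 : cocycle_fun 1 1 = 1
}.

Definition is_ordering (gT : finGroupType) (n : nat) (s : 'I_n.+1 -> gT) : Prop :=
  bijective s /\ s ord0 = 1.

Definition cocycle_mx (gT : finGroupType) (n : nat) (s : 'I_n.+1 -> gT)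
    (psi : cocycle gT) : 'M[int]_n.+1 :=
  \matrix_(i, j) val (psi (s i) (s j)).

Definition RE (n : nat) (M : 'M[int]_n.+1) : int :=
  (\sum_(i < n.+1 | i != ord0) `|\sum_(j < n.+1) M i j|)%R.

Definition quasi_orthogonal (t : nat) (gT : finGroupType)
    (s : 'I_(4 * t).+2 -> gT) (psi : cocycle gT) : Prop :=
  RE (cocycle_mx s psi) = ((4 * t)%N%:Z)%R.

(* The central extension of gT by {1, -1} defined by psi. *)

Definition extension (gT : finGroupType) (psi : cocycle gT) : Type :=
  (pm1 * gT)%type.
HB.instance Definition _ (gT : finGroupType) (psi : cocycle gT) :=
  Finite.on (extension psi).

Definition ext_mul (gT : finGroupType) (psi : cocycle gT)
    (x y : extension psi) : extension psi :=
  (x.1 * y.1 * psi x.2 y.2, x.2 * y.2).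
Definition ext_one (gT : finGroupType) (psi : cocycle gT) : extension psi :=
  (1, 1).
Definition ext_inv (gT : finGroupType) (psi : cocycle gT)
    (x : extension psi) : extension psi :=
  (x.1 * psi x.2^-1 x.2, x.2^-1).

Lemma cocycle1g (gT : finGroupType) (psi : cocycle gT) g : psi 1 g = 1.
Proof.
by have := cocycleP psi 1 1 g; rewrite !mul1g cocycle11 mul1g pm1_sqr.
Qed.

Fact ext_mulA (gT : finGroupType) (psi : cocycle gT) :
  associative (@ext_mul gT psi).
Proof.
move=> [u g] [v h] [w k]; congr (_, _) => /=; last by rewrite mulgA.
rewrite -!mulgA (mulgA (psi g h)) (pm1_mulC (psi g h)) -(mulgA w) cocycleP.
by rewrite (pm1_mulC (psi g _)).
Qed.

Fact ext_mul1 (gT : finGroupType) (psi : cocycle gT) :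
  left_id (@ext_one gT psi) (@ext_mul gT psi).
Proof.
by move=> [u g]; rewrite /ext_mul /= cocycle1g !mul1g mulg1.
Qed.

Fact ext_mulV (gT : finGroupType) (psi : cocycle gT) :
  left_inverse (@ext_one gT psi) (@ext_inv gT psi) (@ext_mul gT psi).
Proof.
move=> [u g]; congr (_, _) => /=; last by rewrite mulVg.
by rewrite -mulgA pm1_sqr.
Qed.

HB.instance Definition _ (gT : finGroupType) (psi : cocycle gT) :=
  Finite_isGroup.Build (extension psi)
    (@ext_mulA gT psi) (@ext_mul1 gT psi) (@ext_mulV gT psi).

Definition ext_center (gT : finGroupType) (psi : cocycle gT) :
    {set extension psi} := [set ((1, 1) : extension psi); (pm1_neg, 1)].

Definition ext_section (gT : finGroupType) (psi : cocycle gT) :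
    {set extension psi} := [set ((1, g) : extension psi) | g : gT].

Definition central_order2 (eT : finGroupType) (E Z : {set eT}) : Prop :=
  [/\ group_set Z, Z \subset 'Z(E) & #|Z| = 2].

Definition quasi_Hadamard (t : nat) (eT : finGroupType) (E : {group eT})
    (Z T : {set eT}) : Prop :=
  [/\ (0 < t)%N, #|E| = (8 * t + 4)%N, central_order2 E Z,
      is_transversal T (rcosets Z E) E
    & exists S : {set eT},
        [/\ S \subset T :\: Z, #|S| = (2 * t + 1)%N,
            forall x, x \in S -> #|T :&: x *: T| = (2 * t + 1)%N
          & forall x, x \in T :\: (S :|: Z) ->
              #|T :&: x *: T| \in [:: (2 * t)%N; (2 * t + 2)%N]]].

Lemma quasi_Hadamard_transversal (t : nat) (eT : finGroupType)
    (E : {group eT}) (Z T : {set eT}) :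
  quasi_Hadamard t E Z T -> is_transversal T (rcosets Z E) E.
Proof. by case. Qed.

(* In what follows G = gT is identified with E / Z through a fixed isomorphism
   f : G -> E / Z. *)

Definition coset_section (gT eT : finGroupType) (Z : {group eT})
    (T : {set eT}) (f : gT -> coset_of Z) (g : gT) : eT :=
  transversal_repr 1 T (f g).

Definition transversal_defect (gT eT : finGroupType) (Z : {group eT})
    (T : {set eT}) (f : gT -> coset_of Z) (g h : gT) : eT :=
  coset_section T f g * coset_section T f h * (coset_section T f (g * h))^-1.

(* The isomorphism from a group Z of order 2 to {1, -1}; values outside Z are
   irrelevant, see transversal_defect_in. *)
Definition sign_of (eT : finGroupType) (z : eT) : pm1 :=
  if z == 1 then 1 else pm1_neg.

Lemma sign_ofM (eT : finGroupType) (Z : {group eT}) :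
  #|Z| = 2 -> {in Z &, {morph @sign_of eT : x y / x * y}}.
Proof.
move=> oZ.
have [z zZ z1]: exists2 z, z \in Z & z != 1.
  by apply/trivgPn; rewrite trivg_card1 oZ.
have defZ x : x \in Z -> x = 1 \/ x = z.
  move=> xZ; apply/pred2P; apply: contraT; rewrite negb_or => /andP[x1 xz].
  have: [set 1; z; x] \subset Z.
    by rewrite !subUset !sub1set group1 zZ xZ.
  move/subset_leq_card; rewrite oZ -setUA cardsU1 !inE cards2.
  by rewrite (eq_sym 1) (negPf z1) (eq_sym 1) (negPf x1) (eq_sym z) xz.
have zz : z * z = 1.
  case: (defZ _ (groupM zZ zZ)) => // /(canRL (mulgK _)).
  by rewrite mulgV => /eqP; rewrite (negPf z1).
move=> x y /defZ[]-> /defZ[]->; rewrite /sign_of ?zz ?mul1g ?mulg1 ?eqxx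
  ?(negPf z1) ?mul1g ?mulg1 //.
by rewrite pm1_sqr.
Qed.

Lemma coset_sectionP (gT eT : finGroupType) (E Z : {group eT}) (T : {set eT})
    (f : {morphism [set: gT] >-> coset_of Z}) :
  Z \subset 'Z(E) -> is_transversal T (rcosets Z E) E ->
  isom [set: gT] (E / Z) f ->
  forall g, [/\ coset_section T f g \in E, coset_section T f g \in 'N(Z),
                coset_section T f g \in T
              & coset Z (coset_section T f g) = f g].
Proof.
move=> cZE trT /isomP[_ fE] g.
have nZE: E \subset 'N(Z) by apply/cents_norm/subsetP=> x xE;
  apply/centP=> z /(subsetP cZE)/centerP[_ cz]; exact/commute_sym/cz.
have: f g \in E / Z by rewrite -fE; apply: mem_morphim; rewrite inE.
case/morphimP=> x xN xE fgx.
have Pfg: (f g : {set eT}) \in rcosets Z E.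
  by apply/rcosetsP; exists x; rewrite // fgx val_coset.
have sfg := repr_mem_pblock trT 1 Pfg.
have sT := repr_mem_transversal trT 1 Pfg.
have sE := subsetP (transversal_sub trT) _ sT.
split=> //; first exact: (subsetP nZE).
exact: coset_mem.
Qed.

Lemma transversal_defect_in (gT eT : finGroupType) (E Z : {group eT})
    (T : {set eT}) (f : {morphism [set: gT] >-> coset_of Z}) :
  Z \subset 'Z(E) -> is_transversal T (rcosets Z E) E ->
  isom [set: gT] (E / Z) f ->
  forall g h, transversal_defect T f g h \in Z.
Proof.
move=> cZE trT isof g h; have sP := coset_sectionP cZE trT isof.
have [_ Ng _ eg] := sP g; have [_ Nh _ eh] := sP h.
have [_ Ngh _ egh] := sP (g * h).
apply: coset_idr; first by rewrite !(groupM, groupV).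
rewrite !morphM ?groupM ?groupV // morphV //= eg eh egh morphM ?inE //.
by rewrite mulgV.
Qed.

Fact transversal_cocycleP (gT eT : finGroupType) (E Z : {group eT})
    (T : {set eT}) (f : {morphism [set: gT] >-> coset_of Z}) :
  Z \subset 'Z(E) -> #|Z| = 2 -> is_transversal T (rcosets Z E) E ->
  isom [set: gT] (E / Z) f ->
  let psi g h := sign_of (transversal_defect T f g h) in
  forall g h k, psi g h * psi (g * h) k = psi g (h * k) * psi h k.
Proof.
move=> cZE oZ trT isof psi g h k.
have sP := coset_sectionP cZE trT isof.
have dZ := transversal_defect_in cZE trT isof.
rewrite /psi -!(sign_ofM oZ) //; congr (sign_of _).
have dE a b : coset_section T f a * coset_section T f b
    = transversal_defect T f a b * coset_section T f (a * b).
  by rewrite mulgKV.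
apply: (mulIg (coset_section T f (g * h * k))).
rewrite -mulgA -dE mulgA -dE.
have [gE _ _ _] := sP g.
have /centerP[_ /(_ _ gE) czg] := subsetP cZE _ (dZ h k).
have /centerP[_ /(_ _ (subsetP (center_sub _) _ (subsetP cZE _ (dZ g (h * k))))) czz]
  := subsetP cZE _ (dZ h k).
by rewrite -czz -(mulgA g) -(mulgA (transversal_defect _ _ h k)) -dE mulgA czg
  -[RHS]mulgA -dE mulgA.
Qed.

Fact transversal_cocycle11 (gT eT : finGroupType) (E Z : {group eT})
    (T : {set eT}) (f : {morphism [set: gT] >-> coset_of Z}) :
  is_transversal T (rcosets Z E) E -> 1 \in T ->
  sign_of (transversal_defect T f 1 1) = 1.
Proof.
move=> trT T1; rewrite /transversal_defect mulg1 mulgK.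
have PZ: (Z : {set eT}) \in rcosets Z E.
  by apply/rcosetsP; exists 1; rewrite ?mulg1.
suff ->: coset_section T f 1 = 1 by rewrite /sign_of eqxx.
have: 1 \in [set transversal_repr 1 T Z].
  by rewrite -(setI_transversal_pblock trT 1 PZ) inE T1 group1.
by move/set1P=> E1; rewrite /coset_section morph1 -(morph1 (coset Z)) coset1 -E1.
Qed.

Definition transversal_cocycle (gT eT : finGroupType) (E Z : {group eT})
    (T : {set eT}) (f : {morphism [set: gT] >-> coset_of Z})
    (cZE : Z \subset 'Z(E)) (oZ : #|Z| = 2)
    (isof : isom [set: gT] (E / Z) f)
    (trT : is_transversal T (rcosets Z E) E) (T1 : 1 \in T) : cocycle gT :=
  Cocycle (transversal_cocycleP cZE oZ trT isof)
          (transversal_cocycle11 f trT T1).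

(* Main.v *)
(**
Multiplying inside the extension shows that, for x in T lying over g, the
number |T :&: x *: T| counts the entries 1 of the row of psi indexed by g; this
turns (ii) into a computation.  For (i), let chi(g) be the parity of that
number.  Multiplying the cocycle identity over its third argument shows that chi
is a homomorphism, because |G| is even.  As |G| = 2 mod 4, a row with chi = 0
has row sum of absolute value at least 2.  Were chi trivial, RE would be at
least 2(4t + 1) > 4t; so its kernel has order 2t + 1, its 2t nontrivial rows
already contribute 4t, and every other estimate is an equality.
*)

Require Import Defs.
From HB Require Import structures.
From mathcomp Require Import all_boot all_order all_algebra all_fingroup all_solvable.
From mathcomp Require Import zify.

Set Implicit Arguments.
Unset Strict Implicit.
Unset Printing Implicit Defensive.

Import GroupScope.

(** * Rows of a cocycle: sums, numbers of ones, and their parity *)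

Lemma pm1_neq1 (u : pm1) : u != 1 -> u = pm1_neg.
Proof.
case: u => u hu; rewrite -!val_eqE /= => u1.
by apply: val_inj => /=; move: hu; rewrite !inE (negPf u1) => /eqP.
Qed.

Lemma val_pm1 (u : pm1) : val u = ((-1) ^+ (u != 1)%g)%R.
Proof. by case: eqVneq => [->|/pm1_neq1->]. Qed.

(** The predecessor removes [x0], itself outside [A]. Both directions use it with [x0 = 1] and 2t +
    1 elements in [A], out of 4t + 2. *)
Lemma sum_notin (T : finType) (x0 : T) (A : {set T}) : x0 \notin A ->
  (\sum_(x | x != x0) (x \notin A) = (#|T| - #|A|).-1)%N.
Proof.
move=> x0A; rewrite -(cardsC A) addKn -[in RHS]sum1_card [in RHS]big_mkcond.
rewrite [in RHS](bigD1 x0) //= inE x0A add1n.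
by apply: eq_bigr => x _; rewrite inE; case: (x \in A).
Qed.

Section RowCounts.

Variables (gT : finGroupType) (psi : cocycle gT).
Implicit Types g h : gT.

Lemma cocycleg1 g : psi g 1 = 1.
Proof.
have := cocycleP psi g 1 1; rewrite !mulg1 cocycle11 mulg1 => e.
by apply: (mulgI (psi g 1)); rewrite e mulg1.
Qed.

Definition row_ones g := #|[set h | psi g h == 1]|.
(** The absolute row sum, by [cocycle_row_sum]; kept in [nat] so that it can be bounded and summed
    there. *)
Definition row_excess g := absz ((row_ones g * 2)%N%:Z - #|[set: gT]|%:Z)%R.

Lemma row_ones_compl g :
  (row_ones g + #|[set h | psi g h != 1%g]| = #|[set: gT]|)%N.
Proof.
rewrite cardsT -(cardsC [set h | psi g h == 1]); congr (_ + _)%N.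
by apply: eq_card => h; rewrite !inE.
Qed.

Lemma cocycle_row_sum g :
  (\sum_h val (psi g h) = (row_ones g * 2)%N%:Z - #|[set: gT]|%:Z :> int)%R.
Proof.
rewrite (bigID (fun h => h \in [set h | psi g h == 1%g])) /=.
rewrite (eq_bigr (fun=> 1%R)) => [|h]; last by rewrite inE => /eqP->.
rewrite [X in (_ + X)%R](eq_bigl (fun h => h \in [set h | psi g h != 1%g]))
  => [|h]; last by rewrite !inE.
rewrite [X in (_ + X)%R](eq_bigr (fun=> (-1)%R)) => [|h]; last first.
  by rewrite inE => /pm1_neq1->.
rewrite !GRing.sumr_const -(row_ones_compl g) -/(row_ones g) GRing.mulNrn.
rewrite !natz; lia.
Qed.

(** Rows and columns are reindexed along [s]; as [s ord0 = 1], the omitted row is that of the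
    identity, whatever the ordering. *)
Lemma RE_row_excess n (s : 'I_n.+1 -> gT) : is_ordering s ->
  RE (cocycle_mx s psi) = (\sum_(g : gT | g != 1%g) row_excess g)%N%:Z%R.
Proof.
case=> bij_s s0; have inj_s := bij_inj bij_s.
rewrite [RHS](big_morph Posz PoszD (erefl _)).
rewrite [RHS](reindex s) /=; last exact: onW_bij.
apply: eq_big => [i|i _]; first by rewrite -(inj_eq inj_s) s0.
rewrite /row_excess -abszE -cocycle_row_sum (reindex s) /=; last exact: onW_bij.
by congr (absz _); apply: eq_bigr => j _; rewrite mxE.
Qed.

(** The map chi, with [bool] under [(+)] as the group of order 2. *)
Definition row_parity g := odd (row_ones g).

Lemma row_parityM (g h : gT) : ~~ odd #|[set: gT]| ->
  row_parity (g * h) = row_parity g (+) row_parity h.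
Proof.
move=> evG.
(* The product of a row counts its entries -1; the order being even, their number has the parity of
   the number of ones. *)
have prodE a : (\prod_k val (psi a k) = (-1) ^+ row_parity a :> int)%R.
  rewrite (bigID (fun k => k \in [set k | psi a k == 1%g])) /=.
  rewrite big1 => [|k]; last by rewrite inE => /eqP->.
  rewrite (eq_bigl (fun k => k \in [set k | psi a k != 1%g]))
    => [|k]; last by rewrite !inE.
  rewrite (eq_bigr (fun=> (-1)%R)) => [|k]; last by rewrite inE => /pm1_neq1->.
  rewrite GRing.prodr_const GRing.mul1r -GRing.signr_odd; congr (_ ^+ nat_of_bool _)%R.
  by move: evG; rewrite -(row_ones_compl a) oddD negb_add => /eqP.
have : (\prod_k (val (psi g h) * val (psi (g * h)%g k)) =
       \prod_k (val (psi g (h * k)%g) * val (psi h k)) :> int)%R.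
  by apply: eq_bigr => k _; have /(congr1 val) := cocycleP psi g h k.
(* Translation by [h] permutes the group, so this product is that of the whole row of [g]. *)
rewrite !big_split /= [X in (_ = X * _ -> _)%R](_ : _ = \prod_k val (psi g k))%R; last first.
  by rewrite [RHS](reindex_inj (mulgI h)).
(* The constant factor [psi g h] occurs an even number of times and drops out. *)
rewrite !prodE GRing.prodr_const -cardsT val_pm1 -GRing.exprM mulnC GRing.exprM.
rewrite -(GRing.signr_odd _ #|_|) (negPf evG) GRing.expr1n GRing.mul1r.
rewrite -GRing.signr_addb.
by case: row_parity; case: (_ (+) _).
Qed.

Lemma quasi_orthogonal_rows t :
  (#|[set: gT]| = 4 * t + 2)%N ->
  (\sum_(g : gT | g != 1%g) row_excess g = 4 * t)%N ->
  (forall g, g != 1 -> row_excess g = (2 * ~~ row_parity g)%N) /\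
  #|[set g | row_parity g]| = (2 * t + 1)%N.
Proof.
move=> oG sumG; have evG : ~~ odd #|[set: gT]| by rewrite oG; lia.
(* For an even number r of ones, 2r - (4t + 2) is 2 mod 4, hence of absolute value at least 2. *)
have leE g : (2 * ~~ row_parity g <= row_excess g)%N.
  by rewrite /row_excess /row_parity oG; case: (boolP (odd _)) => ?; lia.
have oddE : [exists g, row_parity g].
  apply: contraT => /existsPn allE.
  suff : (\sum_(g : gT | g != 1%g) 2 <= 4 * t)%N.
    by rewrite sum_nat_const cardC1 -cardsT oG; lia.
  rewrite -sumG; apply: leq_sum => g _.
  by have := leE g; rewrite (allE g).
have [g0 g0odd] := existsP oddE.
have cardO : #|[set g | row_parity g]| = (2 * t + 1)%N.
  have := cardsC [set g | row_parity g]; rewrite -cardsT oG.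
  (* Translation by an odd element exchanges odd and even rows, so each kind is half of the
     group. *)
  suff -> : ~: [set g | row_parity g] = g0^-1 *: [set g | row_parity g].
    by rewrite card_lcoset; lia.
  by apply/setP => g; rewrite mem_lcoset !inE invgK row_parityM // g0odd.
split=> //.
(* With its equality case attached, the termwise bound can be summed; equal totals then force
   equality in every term. *)
have leifE g : g != 1%g -> (2 * ~~ row_parity g <= row_excess g
    ?= iff (2 * ~~ row_parity g == row_excess g))%N by split.
have [_] := leqif_sum leifE.
rewrite sumG -big_distrr /=.
have par1 : row_parity 1 = false.
  by have := row_parityM 1 1 evG; rewrite mulg1; case: row_parity.
have sum1 : (\sum_(g : gT | g != 1%g) ~~ row_parity g = 2 * t)%N.
  rewrite (eq_bigr (fun g => nat_of_bool (g \notin [set g | row_parity g]))).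
    by rewrite sum_notin ?inE ?par1 // cardO -cardsT oG; lia.
  by move=> g _; rewrite inE.
rewrite sum1 (_ : 2 * (2 * t) = 4 * t)%N ?eqxx; last by lia.
move=> /esym/forallP eE g g1; apply/esym/eqP.
by have:= eE g; rewrite g1.
Qed.

End RowCounts.

(** * The extension and its section: direction (i) *)

Section Extension.

Variables (gT : finGroupType) (psi : cocycle gT).
Implicit Types x y : extension psi.

Lemma extME x y : x * y = (x.1 * y.1 * psi x.2 y.2, x.2 * y.2).
Proof. by []. Qed.

Lemma extVE x : x^-1 = (x.1 * psi x.2^-1 x.2, x.2^-1).
Proof. by []. Qed.

Lemma in_ext_center x : (x \in ext_center psi) = (x.2 == 1).
Proof.
case: x => u g; rewrite !inE !xpair_eqE /=; case: (g == 1); rewrite ?andbF //.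
by rewrite !andbT; case: eqVneq => //= /pm1_neq1->; rewrite eqxx.
Qed.

Lemma in_ext_section x : (x \in ext_section psi) = (x.1 == 1).
Proof.
apply/imsetP/eqP => [[g _ ->] // | ]; case: x => u g /= ->.
by exists g.
Qed.

Lemma card_extension : #|[set: extension psi]| = (2 * #|[set: gT]|)%N.
Proof. by rewrite !cardsT card_prod card_seq_sub. Qed.

Lemma ext_center_group_set : group_set (ext_center psi).
Proof.
apply/group_setP; split; first by rewrite in_ext_center.
move=> x y; rewrite !in_ext_center => /eqP x1 /eqP y1.
by rewrite extME /= x1 y1 mulg1.
Qed.

(** Centrality holds because the row and the column of [psi] at the identity are constantly 1. *)
Lemma ext_center_central_order2 :
  central_order2 [set: extension psi] (ext_center psi).
Proof.
split; first exact: ext_center_group_set; last by rewrite cards2.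
apply/subsetP => x; rewrite in_ext_center => /eqP x1.
apply/centerP; split; first by rewrite inE.
move=> y _; case: x x1 => u g /= ->; case: y => v h.
rewrite /commute !extME /= cocycle1g cocycleg1 !mulg1 mul1g.
by rewrite (pm1_mulC u).
Qed.

Lemma ext_section_transversal :
  is_transversal (ext_section psi) (rcosets (ext_center psi) [set: extension psi])
    [set: extension psi].
Proof.
have part := rcosets_partition (subsetT (Group ext_center_group_set)).
apply/and3P; split; [exact: part | exact: subsetT |].
apply/forall_inP => _ /rcosetsP[x _ ->]; apply/cards1P.
(* The coset of [x] consists of the two elements over [x.2]. *)
exists (1, x.2); apply/setP => y.
rewrite in_setI in_ext_section mem_rcoset in_ext_center in_set1.
rewrite extME extVE /= -eq_mulgV1; case: y => v h; case: x => u g /=.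
by rewrite xpair_eqE.
Qed.

(** The product of [(1, g)] and [(1, h)] is [(psi g h, g * h)], in the section exactly when
    [psi g h = 1]. *)
Lemma card_ext_sectionI g :
  #|ext_section psi :&: ((1, g) : extension psi) *: ext_section psi|
    = row_ones psi g.
Proof.
have -> : ext_section psi :&: ((1, g) : extension psi) *: ext_section psi
    = [set ((1, g * h) : extension psi) | h in [set h | psi g h == 1]].
  apply/setP => y; apply/setIP/imsetP => [[] | [h]].
    rewrite in_ext_section => /eqP y1 /lcosetP[[v h]].
    rewrite in_ext_section /= => /eqP-> def_y; exists h.
      by rewrite inE -y1 def_y extME /= !mul1g.
    by apply: injective_projections; rewrite ?y1 // def_y.
  rewrite inE => /eqP gh1 ->; rewrite in_ext_section; split=> //.
  apply/lcosetP; exists (1, h); first by rewrite in_ext_section.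
  by rewrite extME /= gh1 !mul1g.
by rewrite card_imset // => h k [/mulgI].
Qed.

End Extension.

Lemma quasi_orthogonal_section t (gT : finGroupType) (s : 'I_(4 * t).+2 -> gT)
    (psi : cocycle gT) :
  (0 < t)%N -> #|[set: gT]| = (4 * t + 2)%N -> is_ordering s ->
  quasi_orthogonal s psi ->
  quasi_Hadamard t [set: extension psi]%G (ext_center psi) (ext_section psi).
Proof.
move=> t0 oG sP; rewrite /quasi_orthogonal RE_row_excess // => -[sumG].
have [excE cardO] := quasi_orthogonal_rows oG sumG.
split=> //; first by rewrite card_extension oG; lia.
- exact: ext_center_central_order2.
- exact: ext_section_transversal.
(* This keeps the set S chosen below away from the center. *)
have par1 : row_parity psi 1 = false.
  have evG : ~~ odd #|[set: gT]| by rewrite oG; lia.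
  by have := row_parityM psi 1 1 evG; rewrite mulg1; case: row_parity.
(* S lies over the odd rows: their excess is 0, so they have exactly 2t + 1 ones. *)
exists [set ((1, g) : extension psi) | g in [set g | row_parity psi g]]; split.
- apply/subsetP => _ /imsetP[g + ->]; rewrite inE => pg.
  rewrite in_setD in_ext_section in_ext_center eqxx andbT /=.
  by apply: contraTneq pg => ->; rewrite par1.
- by rewrite card_imset // => g h [].
- move=> _ /imsetP[g + ->]; rewrite inE card_ext_sectionI => pg.
  have g1 : g != 1 by apply: contraTneq pg => ->; rewrite par1.
  by have := excE g g1; rewrite pg /row_excess oG; lia.
case=> u g; rewrite in_setD in_setU in_ext_section in_ext_center negb_or /=.
case/andP=> /andP[gS g1] /eqP u1; rewrite u1 card_ext_sectionI.
have pg : ~~ row_parity psi g.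
  by apply: contra gS => pg; rewrite u1; apply: imset_f; rewrite inE.
(* Excess 2 means 2r = 4t + 2 ± 2, so r is 2t or 2t + 2. *)
by have := excE g g1; rewrite (negPf pg) /row_excess oG !inE; lia.
Qed.

(** * Transversals and their cocycles: direction (ii) *)

Section TransversalCocycle.

Variables (gT eT : finGroupType) (E Z : {group eT}) (T : {set eT}).
Variable f : {morphism [set: gT] >-> coset_of Z}.
Hypotheses (cZE : Z \subset 'Z(E)) (oZ : #|Z| = 2).
Hypothesis isof : isom [set: gT] (E / Z) f.
Hypotheses (trT : is_transversal T (rcosets Z E) E) (T1 : 1 \in T).

Local Notation sec := (coset_section T f).
Local Notation psiT := (transversal_cocycle cZE oZ isof trT T1).

Let secP := coset_sectionP cZE trT isof.

Lemma coset_section_inj : injective sec.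
Proof.
move=> g h eq_gh; have /isomP[/injmP injf _] := isof.
have [_ _ _ eg] := secP g; have [_ _ _ eh] := secP h.
by apply: injf; rewrite ?inE // -eg -eh eq_gh.
Qed.

Lemma coset_section_onto x : x \in T -> exists g, x = sec g.
Proof.
move=> xT; have /isomP[_ fE] := isof.
have xE := subsetP (transversal_sub trT) x xT.
have nZE : E \subset 'N(Z).
  by rewrite cents_norm // centsC (subset_trans cZE) // subIset // subxx orbT.
have xN := subsetP nZE x xE.
have: coset Z x \in E / Z by apply: mem_quotient.
rewrite -fE => /morphimP[g _ _ fg]; exists g.
have Pfg : (f g : {set eT}) \in rcosets Z E.
  by apply/rcosetsP; exists x; rewrite // -fg val_coset.
(* The coset [f g] meets [T] only in its representative, and [x] lies in both. *)
apply/set1P; rewrite -(setI_transversal_pblock trT 1 Pfg) inE xT -fg val_coset //.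
exact: rcoset_refl.
Qed.

Lemma coset_section1 : sec 1 = 1.
Proof.
have [k def1] := coset_section_onto T1; have [_ _ _ ek] := secP k.
have /isomP[/injmP injf _] := isof.
suff k1 : k = 1 by rewrite -[in LHS]k1 -def1.
by apply: injf; rewrite ?inE // -ek -def1 !morph1.
Qed.

Lemma coset_section_inZ g : (sec g \in Z) = (g == 1).
Proof.
apply/idP/eqP => [gZ | ->]; last by rewrite coset_section1 group1.
have /isomP[/injmP injf _] := isof; have [_ _ _ eg] := secP g.
by apply: injf; rewrite ?inE // -eg morph1 coset_id.
Qed.

(** The product [sec g * sec h] lies over [g * h], and the only element of [T] there is
    [sec (g * h)]. *)
Lemma transversal_cocycle_eq1 g h : (psiT g h == 1) = (sec g * sec h \in T).
Proof.
rewrite /= /sign_of; have -> : (transversal_defect T f g h == 1)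
    = (sec g * sec h == sec (g * h)) by rewrite [RHS]eq_mulgV1.
case: (sec g * sec h =P sec (g * h)) => [-> | neq_gh]; first by have [_ _ ->] := secP (g * h); rewrite eqxx.
apply/esym/negbTE/negP => /coset_section_onto[k def_k]; case: neq_gh.
have /isomP[/injmP injf _] := isof.
have [_ Ng _ eg] := secP g; have [_ Nh _ eh] := secP h.
have [_ _ _ ek] := secP k.
rewrite def_k; congr sec; apply: injf; rewrite ?inE // -ek -def_k.
by rewrite [RHS]morphM ?inE // [LHS]morphM //= eg eh.
Qed.

(** As [sec] enumerates [T], the translate consists of the products [sec g * sec h]; this is the
    analogue of [card_ext_sectionI]. *)
Lemma card_transversalI g : #|T :&: sec g *: T| = row_ones psiT g.
Proof.
have -> : T :&: sec g *: T = [set sec g * sec h | h in [set h | psiT g h == 1]].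
  apply/setP => y; apply/setIP/imsetP => [[yT /lcosetP[z zT def_y]] | [h]].
    have [h def_z] := coset_section_onto zT; exists h; last by rewrite -def_z.
    by rewrite inE transversal_cocycle_eq1 -def_z -def_y.
  rewrite inE transversal_cocycle_eq1 => ghT ->; split=> //.
  by rewrite mem_lcoset mulKg; have [] := secP h.
by rewrite card_imset // => h k /mulgI/coset_section_inj.
Qed.

End TransversalCocycle.

Lemma quasi_Hadamard_cocycle t (gT : finGroupType) (s : 'I_(4 * t).+2 -> gT)
    (eT : finGroupType) (E Z : {group eT}) (cZE : Z \subset 'Z(E))
    (oZ : #|Z| = 2) (f : {morphism [set: gT] >-> coset_of Z})
    (isof : isom [set: gT] (E / Z) f) (T : {set eT})
    (trT : is_transversal T (rcosets Z E) E) (T1 : 1 \in T) :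
  #|[set: gT]| = (4 * t + 2)%N -> is_ordering s -> quasi_Hadamard t E Z T ->
  quasi_orthogonal s (transversal_cocycle cZE oZ isof trT T1).
Proof.
move=> oG sP [t0 _ _ _ [S [sST cardS inS outS]]].
rewrite /quasi_orthogonal RE_row_excess //; congr Posz.
set sec := coset_section T f.
pose A := [set g | sec g \in S].
have cardA : #|A| = (2 * t + 1)%N.
  rewrite -cardS -(card_imset _ (coset_section_inj cZE isof trT)); apply: eq_card => x.
  apply/imsetP/idP => [[g + ->] | xS]; first by rewrite inE.
  have /setDP[xT _] := subsetP sST x xS.
  have [g def_x] := coset_section_onto cZE isof trT xT.
  by exists g; rewrite // inE /sec -def_x.
have A1 : 1 \notin A.
  rewrite inE; apply/negP => /(subsetP sST)/setDP[_].
  by rewrite (coset_section_inZ cZE isof trT) ?eqxx.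
(* Rows over [S] sum to 0; the other 2t nonidentity rows contribute 2 each, their numbers of ones
   being off by 1 from half the order. *)
rewrite (eq_bigr (fun g => 2 * (g \notin A))%N) => [|g g1].
  by rewrite -big_distrr /= sum_notin // -cardsT oG cardA; lia.
rewrite /row_excess -card_transversalI inE oG -/sec.
have [/inS-> | gS] := boolP (sec g \in S); first by lia.
have := outS (sec g); rewrite in_setD in_setU negb_or gS /=.
rewrite (coset_section_inZ cZE isof trT) // g1; have [_ _ -> _] := coset_sectionP cZE trT isof g.
by move=> /(_ isT); rewrite !inE => /pred2P[]->; lia.
Qed.

Theorem theorem1 (t : nat) (gT : finGroupType) (s : 'I_(4 * t).+2 -> gT)
    (t_gt0 : (1 <= t)%N) (oG : #|[set: gT]| = (4 * t + 2)%N)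
    (sP : is_ordering s) :
  (forall psi : cocycle gT, quasi_orthogonal s psi ->
     quasi_Hadamard t [set: extension psi]%G (ext_center psi) (ext_section psi))
  /\
  (forall (eT : finGroupType) (E Z : {group eT})
          (cZE : Z \subset 'Z(E)) (oZ : #|Z| = 2)
          (f : {morphism [set: gT] >-> coset_of Z})
          (isof : isom [set: gT] (E / Z) f)
          (T : {set eT}) (qT : quasi_Hadamard t E Z T) (T1 : 1 \in T),
     quasi_orthogonal s
       (transversal_cocycle cZE oZ isof (quasi_Hadamard_transversal qT) T1)).
Proof.
split=> [psi | eT E Z cZE oZ f isof T qT T1].
  exact: quasi_orthogonal_section.
exact: quasi_Hadamard_cocycle.
Qed.
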